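(* Let $H\subseteq\mathcal F_{25}$ and $0\le p\le q\le\infty$. Put $$I_0=\{\rho,\omega,\zeta,\delta,\nu,\alpha,\beta,s,\chi,\tau,\iota_2\},\qquad I_D=I_0\cup\{\omega_D,\zeta_D,\nu_D,\alpha_D,\xi,\iota_2^D\},$$ $$a=\max\{p,\mathbf 1_{\mu\in H}\},\qquad b=\max\{q,\mathbf 1_{H\cap\{\mu,\mu_D\}\ne\varnothing}\}.$$ Let $p^*=\sup\{n\ge1:\mathcal U(H,p,q)\models\gamma_n\}$ and $q^*=\sup\{n\ge1:\mathcal U(H,p,q)\models\gamma_n^D\}$, where the supremum of the empty set is $0$. Then $$p^*=\begin{cases}\infty,&H\cap I_0\ne\varnothing\text{ or }(\eta\in H\text{ and }a\ge1),\\ a,&\text{otherwise},\end{cases}$$ $$q^*=\begin{cases}\infty,&H\cap I_D\ne\varnothing\text{ or }(H\cap\{\eta,\eta_D\}\ne\varnothing\text{ and }b\ge1),\\ b,&\text{otherwise}.\end{cases}$$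
   Context: Language: two binary operations $+,\cdot$, no constants. $u\preceq v$ abbreviates $u+v\approx v$. $\mathbf 1_{P}$ is $1$ if $P$ holds and $0$ otherwise. The semiring $R_{12}$: its universe is $\{0,c,p,q,a,b\}$ (letters used as elements only in this paragraph); multiplication is commutative with only nonzero products $pb=bp=ab=ba=aq=qa=c$; addition is the join of the partial order generated by $a<p<0$, $b<q<0$, $c<0$, $a<c$, $b<q<c$. $\mathcal V=\mathsf V(R_{12})$ is the variety generated by $R_{12}$, and $\mathcal V[E]$ is the subvariety of $\mathcal V$ defined by adjoining the identities in $E$. Abbreviations: $C(t,u)=t+tu$, $D(t,u)=t+u+tu$, $L(a,b,c,d)=ab+bc+cd$ (all letters in identities are variables). $\mathcal F_{25}$ consists of the 25 identities: $\rho: x\preceq xy$; $\eta: z\preceq x+xy+yz$; $\omega: y\preceq x+xy$; $\zeta: z\preceq C(x,y)+zt$; $\lambda: z\preceq D(x,y)+xz$; $\eta_D: z\preceq x+xy+yz+D(t,u)$; $\omega_D: y\preceq C(x,y)+D(t,u)$; $\zeta_D: z\preceq D(x,y)+zt$; $\mu: ad\preceq b+L(a,b,c,d)$; $\nu: ad\preceq C(t,u)+L(a,b,c,d)$; $\mu_2: ad\preceq b+c+L(a,b,c,d)$; $\mu_D: ad\preceq b+L(a,b,c,d)+D(t,u)$; $\nu_D: ad\preceq L(a,b,c,d)+D(t,u)$; $\delta: ad\preceq L(a,b,c,d)$; $\xi: x^2\approx D(x,y)$; $\beta: xz\preceq C(x,y)+C(t,z)$; $s: x^2\approx C(x,y)$;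 $\chi: x^2\approx xy$; $\tau: x\approx y$; $\alpha: ad\preceq a+L(a,b,c,d)$; $\alpha_D: ad\preceq a+L(a,b,c,d)+D(t,u)$; $\varepsilon: ad\preceq a+b+c+L(a,b,c,d)$; $\kappa: ad\preceq a+b+L(a,b,c,d)$; $\iota_2: x_0x_5\preceq x_1+\sum_{j=0}^4x_jx_{j+1}$; $\iota_2^D: x_0x_5\preceq x_1+\sum_{j=0}^4x_jx_{j+1}+D(t,u)$. For $n\ge1$: $$\gamma_n:\ x_0y\preceq x_0+x_{2n}+\sum_{j=0}^{2n-1}x_jx_{j+1}+x_{2n}y,\qquad \gamma_n^D:\ x_0y\preceq x_0+x_{2n}+\sum_{j=0}^{2n-1}x_jx_{j+1}+x_{2n}y+D(t,u).$$ $\mathcal U(H,p,q)=\mathcal V[H,\ \gamma_i:1\le i\le p,\ \gamma_j^D:1\le j\le q]$ (threshold $0$ gives an empty family, $\infty$ the whole family). *)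

(* Defs.v *)
From HB Require Import structures.
From mathcomp Require Import all_boot.

Set Implicit Arguments.
Unset Strict Implicit.
Unset Printing Implicit Defensive.

Record algebra := Algebra {
  carrier :> Type;
  add : carrier -> carrier -> carrier;
  mul : carrier -> carrier -> carrier
}.

(* A countable supply of pairwise distinct variables: nine letters and the
   indexed variables x_0, x_1, ... *)
Inductive var := Va | Vb | Vc | Vd | Vt | Vu | Vx | Vy | Vz | Vi of nat.

Inductive term :=
  | Var of var
  | Add of term & term
  | Mul of term & term.

Record identity := Identity { lhs : term; rhs : term }.

Declare Scope term_scope.
Delimit Scope term_scope with T.
Bind Scope term_scope with term.
Notation "u + v" := (Add u v) : term_scope.
Notation "u * v" := (Mul u v) : term_scope.
Notation "u ≈ v" := (Identity u%T v%T) (at level 70, no associativity).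
Notation "u ⪯ v" := (Identity (Add u%T v%T) v%T)
  (at level 70, no associativity).

Fixpoint eval (A : algebra) (e : var -> A) (u : term) : A :=
  match u with
  | Var v => e v
  | Add u1 u2 => add (eval e u1) (eval e u2)
  | Mul u1 u2 => mul (eval e u1) (eval e u2)
  end.

Definition satisfies (A : algebra) (E : identity) : Prop :=
  forall e : var -> A, eval e (lhs E) = eval e (rhs E).

(* [class_satisfies K E] is K |= E. *)
Definition class_satisfies (K : algebra -> Prop) (E : identity) : Prop :=
  forall A : algebra, K A -> satisfies A E.

Definition is_hom (A B : algebra) (f : A -> B) : Prop :=
  (forall x y, f (add x y) = add (f x) (f y)) /\
  (forall x y, f (mul x y) = mul (f x) (f y)).

Definition prod_algebra (I : Type) (F : I -> algebra) : algebra :=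
  @Algebra (forall i, F i)
    (fun f g i => add (f i) (g i)) (fun f g i => mul (f i) (g i)).

(* The least class containing G and closed under homomorphic images,
   subalgebras (up to isomorphism) and arbitrary products.  Algebras are
   nonempty by convention, whence the side condition on subalgebras. *)
Inductive variety_gen (G : algebra) : algebra -> Prop :=
  | vg_base : variety_gen G G
  | vg_hom (A B : algebra) (f : A -> B) :
      is_hom f -> (forall y, exists x, f x = y) ->
      variety_gen G A -> variety_gen G B
  | vg_sub (A B : algebra) (f : A -> B) :
      inhabited A -> is_hom f -> injective f ->
      variety_gen G B -> variety_gen G A
  | vg_prod (I : Type) (F : I -> algebra) :
      (forall i, variety_gen G (F i)) -> variety_gen G (prod_algebra F).

Inductive R12_elt := r0 | rc | rp | rq | ra | rb.

Definition R12_add (x y : R12_elt) : R12_elt :=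
  match x, y with
  | ra, ra => ra
  | rb, rb => rb
  | rp, (rp | ra) | ra, rp => rp
  | rq, (rq | rb) | rb, rq => rq
  | rc, (rc | ra | rb | rq) | (ra | rb | rq), rc
  | ra, (rb | rq) | (rb | rq), ra => rc
  | _, _ => r0
  end.

Definition R12_mul (x y : R12_elt) : R12_elt :=
  match x, y with
  | rp, rb | rb, rp | ra, rb | rb, ra | ra, rq | rq, ra => rc
  | _, _ => r0
  end.

Definition R12 : algebra := Algebra R12_add R12_mul.

(* The partial order generated by a < p < 0, b < q < 0, c < 0, a < c,
   b < q < c, and a check that the table [R12_add] is its join. *)
Inductive R12_le : R12_elt -> R12_elt -> Prop :=
  | le_ap : R12_le ra rp
  | le_p0 : R12_le rp r0
  | le_bq : R12_le rb rq
  | le_q0 : R12_le rq r0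
  | le_c0 : R12_le rc r0
  | le_ac : R12_le ra rc
  | le_qc : R12_le rq rc
  | le_refl x : R12_le x x
  | le_trans y x z : R12_le x y -> R12_le y z -> R12_le x z.

Lemma R12_leE x y : R12_le x y <-> R12_add x y = y.
Proof.
split.
  by elim=> // [[]|[] [] []].
have b0 : R12_le rb r0 by apply: (@le_trans rq); constructor.
have a0 : R12_le ra r0 by apply: (@le_trans rp); constructor.
have bc : R12_le rb rc by apply: (@le_trans rq); constructor.
by case: x; case: y => // _; constructor.
Qed.

Lemma R12_add_join x y z :
  R12_le (R12_add x y) z <-> R12_le x z /\ R12_le y z.
Proof.
split=> [/R12_leE H|[/R12_leE Hx /R12_leE Hy]].
  by split; apply/R12_leE; move: H; case: x; case: y; case: z.
by apply/R12_leE; move: Hx Hy; case: x; case: y; case: z.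
Qed.

Definition Cterm (t u : term) : term := (t + t * u)%T.
Definition Dterm (t u : term) : term := (t + u + t * u)%T.
Definition Lterm (a b c d : term) : term := (a * b + b * c + c * d)%T.

(* [tsum f n] is f 0 + ... + f n  (n+1 summands). *)
Fixpoint tsum (f : nat -> term) (n : nat) : term :=
  match n with
  | 0 => f 0
  | n'.+1 => (tsum f n' + f n)%T
  end.

(* The suffix [D] stands for a subscript or superscript D. *)
Inductive F25 :=
  | Rho | Eta | Omega | Zeta | Lambda | EtaD | OmegaD | ZetaD
  | Mu | Nu | Mu2 | MuD | NuD | Delta | Xi | Beta | S_ | Chi | Tau
  | Alpha | AlphaD | Epsilon | Kappa | Iota2 | Iota2D.

Section Identities.

Local Notation a := (Var Va).
Local Notation b := (Var Vb).
Local Notation c := (Var Vc).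
Local Notation d := (Var Vd).
Local Notation t := (Var Vt).
Local Notation u := (Var Vu).
Local Notation x := (Var Vx).
Local Notation y := (Var Vy).
Local Notation z := (Var Vz).
Local Notation x_ j := (Var (Vi j)).
Local Notation C := Cterm.
Local Notation D := Dterm.
Local Notation L := (Lterm a b c d).

Definition F25_identity (i : F25) : identity :=
  match i with
  | Rho     => x ⪯ x * y
  | Eta     => z ⪯ x + x * y + y * z
  | Omega   => y ⪯ x + x * y
  | Zeta    => z ⪯ C x y + z * t
  | Lambda  => z ⪯ D x y + x * z
  | EtaD    => z ⪯ x + x * y + y * z + D t u
  | OmegaD  => y ⪯ C x y + D t u
  | ZetaD   => z ⪯ D x y + z * t
  | Mu      => a * d ⪯ b + L
  | Nu      => a * d ⪯ C t u + L
  | Mu2     => a * d ⪯ b + c + L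
  | MuD     => a * d ⪯ b + L + D t u
  | NuD     => a * d ⪯ L + D t u
  | Delta   => a * d ⪯ L
  | Xi      => x * x ≈ D x y
  | Beta    => x * z ⪯ C x y + C t z
  | S_      => x * x ≈ C x y
  | Chi     => x * x ≈ x * y
  | Tau     => x ≈ y
  | Alpha   => a * d ⪯ a + L
  | AlphaD  => a * d ⪯ a + L + D t u
  | Epsilon => a * d ⪯ a + b + c + L
  | Kappa   => a * d ⪯ a + b + L
  | Iota2   => x_ 0 * x_ 5 ⪯ x_ 1 + tsum (fun j => x_ j * x_ j.+1)%T 4
  | Iota2D  => x_ 0 * x_ 5 ⪯ x_ 1 + tsum (fun j => x_ j * x_ j.+1)%T 4 + D t u
  end.

(* Meaningful for n >= 1 only, in which case the sum runs over
   0 <= j <= 2n-1. *)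
Definition gamma_rhs (n : nat) : term :=
  (x_ 0 + x_ (2 * n)%N + tsum (fun j => x_ j * x_ j.+1)%T (2 * n).-1
   + x_ (2 * n)%N * y)%T.

Definition gamma (n : nat) : identity := x_ 0 * y ⪯ gamma_rhs n.

Definition gammaD (n : nat) : identity := x_ 0 * y ⪯ gamma_rhs n + D t u.

End Identities.

Definition F25_enum : seq F25 :=
  [:: Rho; Eta; Omega; Zeta; Lambda; EtaD; OmegaD; ZetaD;
      Mu; Nu; Mu2; MuD; NuD; Delta; Xi; Beta; S_; Chi; Tau;
      Alpha; AlphaD; Epsilon; Kappa; Iota2; Iota2D].

Definition F25_code (i : F25) : nat :=
  match i with
  | Rho => 0 | Eta => 1 | Omega => 2 | Zeta => 3 | Lambda => 4
  | EtaD => 5 | OmegaD => 6 | ZetaD => 7 | Mu => 8 | Nu => 9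
  | Mu2 => 10 | MuD => 11 | NuD => 12 | Delta => 13 | Xi => 14
  | Beta => 15 | S_ => 16 | Chi => 17 | Tau => 18 | Alpha => 19
  | AlphaD => 20 | Epsilon => 21 | Kappa => 22 | Iota2 => 23 | Iota2D => 24
  end.

Lemma F25_codeK : cancel F25_code (nth Rho F25_enum).
Proof. by case. Qed.

HB.instance Definition _ := Countable.copy F25 (can_type F25_codeK).

Lemma F25_enumP : Finite.axiom F25_enum.
Proof. by case. Qed.

HB.instance Definition _ := isFinite.Build F25 F25_enumP.

(* The names denote pairwise distinct identities, so that sets of names are
   the same as sets of identities. *)
Lemma F25_identity_inj : injective F25_identity.
Proof. by case=> [] []. Qed.

Inductive enat := Fin of nat | Inf.

Definition ele (m n : enat) : bool :=
  match m, n with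
  | _, Inf => true
  | Fin m', Fin n' => m' <= n'
  | Inf, Fin _ => false
  end.

Definition emax (m n : enat) : enat := if ele m n then n else m.

(* [s] is the supremum of [P] in {0, 1, ..., oo}; it is 0 for empty [P]. *)
Definition is_esup (P : nat -> Prop) (s : enat) : Prop :=
  (forall n, P n -> ele (Fin n) s) /\
  (forall s', (forall n, P n -> ele (Fin n) s') -> ele s s').

Lemma is_esup_unique P s s' : is_esup P s -> is_esup P s' -> s = s'.
Proof.
move=> [ub1 lub1] [ub2 lub2].
move: (lub1 _ ub2) (lub2 _ ub1); case: s {ub1 lub1} => [m|];
  case: s' {ub2 lub2} => [n|] //= mn nm.
by congr Fin; apply/eqP; rewrite eqn_leq mn nm.
Qed.

Definition U (H : {set F25}) (p q : enat) (A : algebra) : Prop :=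
  [/\ variety_gen R12 A,
      forall i, i \in H -> satisfies A (F25_identity i),
      forall n, 1 <= n -> ele (Fin n) p -> satisfies A (gamma n) &
      forall n, 1 <= n -> ele (Fin n) q -> satisfies A (gammaD n)].

Definition I0 : {set F25} :=
  [set:: [:: Rho; Omega; Zeta; Delta; Nu; Alpha; Beta; S_; Chi; Tau; Iota2]].

Definition ID : {set F25} :=
  I0 :|: [set:: [:: OmegaD; ZetaD; NuD; AlphaD; Xi; Iota2D]].

(* Main.v *)
(* In R12 products of degree three and squares are the top element 0, so below a
   nonzero value a term is a graph whose edges are its products and whose marked
   vertices are its linear summands: a nonzero value c of the term orients the
   edges between {a, p} and {b, q}, never joins p to q, and avoids p at marked
   vertices. Read on the elements below a fixed w, nearly all the identities
   are Horn rules on marked graphs, and gamma_n says that two marked vertices at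
   distance 2n share their neighbours.

   Upper values: the identities in I_0 (with a marked edge t - u at hand, those
   in I_D) let one walk along the path of gamma_n for every n; eta marks the
   even vertices of the path, after which gamma_1 is iterated.

   Sharpness: given a set of assignments into R12, call a term below c if its
   value is at most c under all of them, and identify two terms that are below c
   in the same contexts. The quotient lies in the variety, and for suitable
   assignments its terms below c are the subgraphs of a path with marked ends
   x_0, x_2n, respectively of the path x_0 - x_1 - x_2 - x_3 with x_0, x_2
   marked. Adjoining a separate edge t - u with both ends marked makes D(t,u)
   nonzero, which refutes gamma_n^D. *)

Require Import Defs.
From HB Require Import structures.
From mathcomp Require Import all_boot zify.
From mathcomp Require boolp.

Set Implicit Arguments.
Unset Strict Implicit.
Unset Printing Implicit Defensive.

Local Notation "x [+] y" := (Defs.add x y) (at level 50, left associativity).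
Local Notation "x [*] y" := (Defs.mul x y) (at level 40, left associativity).

(** * Preservation of identities in generated varieties *)

Lemma eval_hom (A B : algebra) (f : A -> B) (e : var -> A) t :
  is_hom f -> eval (fun v => f (e v)) t = f (eval e t).
Proof.
case=> fD fM; elim: t => [v|s IHs t IHt|s IHs t IHt] //=.
- by rewrite IHs IHt fD.
- by rewrite IHs IHt fM.
Qed.

Lemma variety_gen_satisfies (G A : algebra) (E : identity) :
  variety_gen G A -> satisfies G E -> satisfies A E.
Proof.
move=> VA GE; elim: VA => {A} //.
- move=> B C f fh f_surj _ BE e.
  have [g gK] := boolp.choice (fun v => f_surj (e v)).
  have -> : e = fun v => f (g v) by apply: boolp.funext => v; rewrite gK.
  by rewrite !eval_hom // BE.
- by move=> B C f _ fh f_inj _ CE e; apply: f_inj; rewrite -!eval_hom.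
- move=> I F _ FE e; apply: boolp.functional_extensionality_dep => i.
  have prh : @is_hom (prod_algebra F) (F i) (fun x => x i) by split.
  rewrite -!(eval_hom _ _ prh). exact: FE.
Qed.

(** * Consequences of the identities *)

Definition le (A : algebra) (x y : A) := x [+] y = y.

(* The premises of [gamma n] with [w] for its right-hand side. *)
Definition chain (A : algebra) n (x : nat -> A) (y w : A) :=
  [/\ le (x 0) w, le (x (2 * n)) w,
      forall j, j < 2 * n -> le (x j [*] x j.+1) w & le (x (2 * n) [*] y) w].

(** Fixing [w] turns the whole family of the $\gamma_n$ into one closure property of the elements
    below [w]; [aboveD] restricts it to the [w] that matter for the $\gamma_n^D$. *)
Definition folds (A : algebra) (w : A) :=
  forall n x y, 0 < n -> chain n x y w -> le (x 0 [*] y) w.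

Definition aboveD (A : algebra) (w : A) :=
  exists t u : A, [/\ le t w, le u w & le (t [*] u) w].

Section Derivations.

Variable A : algebra.
Hypothesis VA : variety_gen R12 A.


Lemma addA (x y z : A) : x [+] (y [+] z) = x [+] y [+] z.
Proof.
have E : satisfies R12
    (Var Va + (Var Vb + Var Vc) ≈ Var Va + Var Vb + Var Vc).
  by move=> e /=; case: (e Va); case: (e Vb); case: (e Vc).
exact: (variety_gen_satisfies VA E
  (fun v => match v with Va => x | Vb => y | _ => z end)).
Qed.

Lemma addC (x y : A) : x [+] y = y [+] x.
Proof.
have E : satisfies R12 (Var Va + Var Vb ≈ Var Vb + Var Va).
  by move=> e /=; case: (e Va); case: (e Vb).
exact: (variety_gen_satisfies VA E
  (fun v => match v with Va => x | _ => y end)).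
Qed.

Lemma mulC (x y : A) : x [*] y = y [*] x.
Proof.
have E : satisfies R12 (Var Va * Var Vb ≈ Var Vb * Var Va).
  by move=> e /=; case: (e Va); case: (e Vb).
exact: (variety_gen_satisfies VA E
  (fun v => match v with Va => x | _ => y end)).
Qed.

Lemma lexx (x : A) : le x x.
Proof.
have E : satisfies R12 (Var Va + Var Va ≈ Var Va).
  by move=> e /=; case: (e Va).
exact: (variety_gen_satisfies VA E (fun v => x)).
Qed.

(** Squares are the top element of [R12]. Hence an identity that puts a square below [w] puts every
    element below [w]. *)
Lemma le_sqr (x y : A) : le y (x [*] x).
Proof.
have E : satisfies R12 (Var Vb ⪯ Var Va * Var Va).
  by move=> e /=; case: (e Va); case: (e Vb).
exact: (variety_gen_satisfies VA E
  (fun v => match v with Va => x | _ => y end)).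
Qed.

Lemma le_trans (y x z : A) : le x y -> le y z -> le x z.
Proof. by rewrite /le => xy <-; rewrite addA xy. Qed.

Lemma le_addl (x y : A) : le x (x [+] y).
Proof. by rewrite /le addA lexx. Qed.

Lemma le_addr (x y : A) : le y (x [+] y).
Proof. by rewrite addC; exact: le_addl. Qed.

Lemma add_le (x y w : A) : le (x [+] y) w <-> le x w /\ le y w.
Proof.
split=> [h|[xw yw]].
  by split; apply: le_trans h; [exact: le_addl | exact: le_addr].
by rewrite /le -addA yw.
Qed.

Lemma mul_leC (x y w : A) : le (x [*] y) w -> le (y [*] x) w.
Proof. by rewrite mulC. Qed.

Lemma le_rule u v (e : var -> A) w :
  satisfies A (u ⪯ v) -> le (eval e v) w -> le (eval e u) w.
Proof. by move=> /(_ e) /= uv; exact: le_trans. Qed.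

Lemma tsum_le (e : var -> A) f m w :
  le (eval e (tsum f m)) w <-> forall j, j <= m -> le (eval e (f j)) w.
Proof.
elim: m => [|m IHm] /=.
  by split=> [h [|//]//|]; apply.
rewrite add_le IHm; split=> [[h1 h2] j|h].
  by rewrite leq_eqVlt => /predU1P[->|]; [exact: h2 | exact: h1].
by split=> [j jm|]; apply: h => //; exact: leqW.
Qed.

Lemma gamma_rhs_le (e : var -> A) n w : 0 < n ->
  le (eval e (gamma_rhs n)) w <->
  chain n (fun j => e (Vi j)) (e Vy) w.
Proof.
move=> n_gt0; rewrite /gamma_rhs /= !add_le tsum_le /=; split.
  case=> -[[h0 h1] h2] h3; split=> // j jn; apply: h2; lia.
case=> h0 h1 h2 h3; split=> //; split=> // j jn; apply: h2; lia.
Qed.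

Lemma gammaP n : 0 < n ->
  satisfies A (gamma n) <->
  forall x y (w : A), chain n x y w -> le (x 0 [*] y) w.
Proof.
move=> n_gt0; split=> [An x y w ch|h e].
  pose e v := match v with Vi j => x j | _ => y end.
  by apply: (le_rule (e := e) An); apply/gamma_rhs_le.
apply: (h (fun j => e (Vi j)) (e Vy)); apply/gamma_rhs_le => //.
exact: lexx.
Qed.

Lemma gammaDP n : 0 < n ->
  satisfies A (gammaD n) <->
  forall x y (w : A), aboveD w -> chain n x y w -> le (x 0 [*] y) w.
Proof.
move=> n_gt0; split=> [An x y w [t [u [tw uw tuw]]] ch|h e].
  pose e v := match v with Vi j => x j | Vt => t | Vu => u | _ => y end.
  apply: (le_rule (e := e) An).
  apply/(add_le (eval e (gamma_rhs n))); split; first exact/gamma_rhs_le.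
  by rewrite !add_le.
rewrite /gammaD; apply: (h (fun j => e (Vi j)) (e Vy)).
  exists (e Vt), (e Vu); split; apply: le_trans (le_addr _ _) => /=.
  - by rewrite -addA; exact: le_addl.
  - by apply: le_trans (le_addl _ _); exact: le_addr.
  - exact: le_addr.
by apply/gamma_rhs_le => //; exact: le_addl.
Qed.

Lemma gamma_gammaD n : 0 < n -> satisfies A (gamma n) -> satisfies A (gammaD n).
Proof.
by move=> n0 /(gammaP n0) h; apply/(gammaDP n0) => x y w _; exact: h.
Qed.

(* If both ends of a path of length 3 are marked (that is, lie below [w]),
   then no end takes the value p, so the product of the ends is c. *)
Lemma le_ends (a b c d w : A) : le a w -> le d w ->
  le (a [*] b) w -> le (b [*] c) w -> le (c [*] d) w -> le (a [*] d) w.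
Proof.
have E : satisfies R12 (Var Va * Var Vd ⪯ Var Va + Var Vd +
    Lterm (Var Va) (Var Vb) (Var Vc) (Var Vd)).
  by move=> e /=; case: (e Va); case: (e Vb); case: (e Vc); case: (e Vd).
move=> aw dw ab bc cd.
pose e v := match v with Va => a | Vb => b | Vc => c | _ => d end.
by apply: (le_rule (e := e) (variety_gen_satisfies VA E)); rewrite /= !add_le.
Qed.

(** * Horn rules that fold paths of every length *)

Definition alpha_rule (w : A) := forall a b c d, le a w ->
  le (a [*] b) w -> le (b [*] c) w -> le (c [*] d) w -> le (a [*] d) w.

Definition omega_rule (w : A) := forall x y, le x w ->
  le (x [*] y) w -> le y w.

Definition eta_rule (w : A) := forall x y z, le x w ->
  le (x [*] y) w -> le (y [*] z) w -> le z w.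

Definition gamma1_rule (w : A) := forall x0 x1 x2 y, le x0 w -> le x2 w ->
  le (x0 [*] x1) w -> le (x1 [*] x2) w -> le (x2 [*] y) w -> le (x0 [*] y) w.

Definition iota_rule (w : A) := forall x0 x1 x2 x3 x4 x5, le x1 w ->
  le (x0 [*] x1) w -> le (x1 [*] x2) w -> le (x2 [*] x3) w ->
  le (x3 [*] x4) w -> le (x4 [*] x5) w -> le (x0 [*] x5) w.

(** Induction joins [x 0] to every odd vertex: the rule is applied to the path $x_0, x_{2k+1},
    x_{2k+2}, x_{2k+3}$, and a last time with [y] as its end. *)
Lemma alpha_folds w : alpha_rule w -> folds w.
Proof.
move=> aw n x y n_gt0 [x0 x2n xx x2ny].
suff h k : k < n -> le (x 0 [*] x (2 * k).+1) w.
  apply: (aw _ (x (2 * n.-1).+1) (x (2 * n))) => //.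
    by apply: h; lia.
  have -> : 2 * n = (2 * n.-1).+2 by lia.
  by apply: xx; lia.
elim: k => [_|k IHk kn]; first by apply: xx; lia.
apply: (aw _ (x (2 * k).+1) (x (2 * k).+2)) => //.
- by apply: IHk; lia.
- by apply: xx; lia.
- by rewrite mulnS; apply: xx; lia.
Qed.

(** The mark of [a] spreads along the path to [d], and then [le_ends] applies. *)
Lemma omega_alpha w : omega_rule w -> alpha_rule w.
Proof.
move=> ow a b c d a_w ab bc cd.
have bw := ow _ _ a_w ab; have cw := ow _ _ bw bc; have dw := ow _ _ cw cd.
exact: (@le_ends _ b c).
Qed.

Lemma gamma1_eta_folds w : eta_rule w -> gamma1_rule w -> folds w.
Proof.
move=> ew gw n x y n_gt0 [x0 x2n xx x2ny].
have even_le k : k <= n -> le (x (2 * k)) w.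
  elim: k => // k IHk kn; rewrite mulnS.
  by apply: (ew (x (2 * k)) (x (2 * k).+1)); [apply: IHk|apply: xx|apply: xx];
    lia.
suff h k : k < n -> le (x 0 [*] x (2 * k).+1) w.
  apply: (gw _ (x (2 * n.-1).+1) (x (2 * n))) => //.
    by apply: h; lia.
  have -> : 2 * n = (2 * n.-1).+2 by lia.
  by apply: xx; lia.
elim: k => [_|k IHk kn]; first by apply: xx; lia.
apply: (gw _ (x (2 * k).+1) (x (2 * k.+1))) => //.
- by apply: even_le; lia.
- by apply: IHk; lia.
- by rewrite mulnS; apply: xx; lia.
- by apply: xx; lia.
Qed.

Lemma iota_folds w : iota_rule w -> folds w.
Proof.
move=> iw n x y n_gt0 [x0 x2n xx x2ny].
have x01 : le (x 0 [*] x 1) w by apply: xx; lia.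
have h k : k < n -> le (x 1 [*] x (2 * k).+2) w.
  elim: k => [_|k IHk kn]; first by apply: xx; lia.
  (* The walk is $x_1, x_0, x_1, x_{2k+2}, x_{2k+3}, x_{2k+4}$: the detour through $x_0$ brings the
     length to five and puts a marked vertex second. *)
  apply: (iw _ (x 0) (x 1) (x (2 * k).+2) (x (2 * k.+1).+1)) => //.
  - exact: mul_leC.
  - by apply: IHk; lia.
  - by rewrite mulnS; apply: xx; lia.
  - by apply: xx; lia.
(* The walk is $y, x_{2n}, x_1, x_0, x_1, x_0$, with the marked vertex $x_{2n}$ second. *)
apply: mul_leC; apply: (iw _ (x (2 * n)) (x 1) (x 0) (x 1)) => //.
- exact: mul_leC.
- apply: mul_leC; have -> : 2 * n = (2 * n.-1).+2 by lia.
  by apply: h; lia.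
- exact: mul_leC.
- exact: mul_leC.
Qed.


Lemma folds_gamma n : 0 < n -> (forall w : A, folds w) -> satisfies A (gamma n).
Proof. by move=> n0 h; apply/gammaP => // x y w; exact: h. Qed.

Lemma folds_gammaD n : 0 < n -> (forall w : A, aboveD w -> folds w) ->
  satisfies A (gammaD n).
Proof. by move=> n0 h; apply/gammaDP => // x y w Dw; exact: h. Qed.

Ltac by_le := rewrite /= ?add_le; do ?split; solve [done | exact: mul_leC].

(** Rho, omega and zeta carry a mark across an edge. For nu the marked edge $C(t,u)$ is [a] - [b]
    itself. The identities s and chi put a square below [w]. *)
Lemma alpha_I0 i (w : A) : i \in I0 :\: [set Beta; Iota2] ->
  satisfies A (F25_identity i) -> alpha_rule w.
Proof.
case: i; rewrite !inE => // _ /= Ai.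
- apply: omega_alpha => x y xw xy.
  pose e v := match v with Vx => y | _ => x end.
  by apply: (le_rule (e := e) Ai); by_le.
- apply: omega_alpha => x y xw xy.
  pose e v := match v with Vx => x | _ => y end.
  by apply: (le_rule (e := e) Ai); by_le.
- apply: omega_alpha => x y xw xy.
  pose e v := match v with Vx => x | Vy => y | Vz => y | _ => x end.
  by apply: (le_rule (e := e) Ai); by_le.
- move=> a b c d aw ab bc cd.
  pose e v := match v with Va | Vt => a | Vb | Vu => b | Vc => c | _ => d end.
  by apply: (le_rule (e := e) Ai); by_le.
- move=> a b c d aw ab bc cd.
  pose e v := match v with Va | Vt => a | Vb | Vu => b | Vc => c | _ => d end.
  by apply: (le_rule (e := e) Ai); by_le.
- move=> a b c d aw ab bc cd.
  have /= E := Ai (fun v => match v with Vx => a | _ => b end).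
  by apply: le_trans (le_sqr a _) _; rewrite E; by_le.
- move=> a b c d aw ab bc cd.
  have /= E := Ai (fun v => match v with Vx => a | _ => b end).
  by apply: le_trans (le_sqr a _) _; rewrite E.
- move=> a b c d aw ab bc cd.
  have /= -> := Ai (fun v => match v with Vx => a [*] d | _ => w end).
  exact: lexx.
- move=> a b c d aw ab bc cd.
  pose e v := match v with Va | Vt => a | Vb | Vu => b | Vc => c | _ => d end.
  by apply: (le_rule (e := e) Ai); by_le.
Qed.

(** The arguments are those of [alpha_I0], with the marked edge now supplied by [aboveD]; xi puts
    the square of [t] below [w]. *)
Lemma alpha_ID i (w : A) : i \in ID :\: I0 :\ Iota2D -> aboveD w ->
  satisfies A (F25_identity i) -> alpha_rule w.
Proof.
case: i; rewrite !inE => // _ [t [u [tw uw tuw]]] /= Ai.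
- apply: omega_alpha => x y xw xy.
  pose e v := match v with Vx => x | Vy => y | Vt => t | _ => u end.
  by apply: (le_rule (e := e) Ai); by_le.
- apply: omega_alpha => x y xw xy.
  pose e v := match v with Vx => t | Vy => u | Vz => y | _ => x end.
  by apply: (le_rule (e := e) Ai); by_le.
- move=> a b c d aw ab bc cd.
  pose e v := match v with
    Va => a | Vb => b | Vc => c | Vd => d | Vt => t | _ => u end.
  by apply: (le_rule (e := e) Ai); by_le.
- move=> a b c d aw ab bc cd.
  have /= E := Ai (fun v => match v with Vx => t | _ => u end).
  by apply: le_trans (le_sqr t _) _; rewrite E; by_le.
- move=> a b c d aw ab bc cd.
  pose e v := match v with
    Va => a | Vb => b | Vc => c | Vd => d | Vt => t | _ => u end.
  by apply: (le_rule (e := e) Ai); by_le.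
Qed.

(** Only the first edge $x_0 - x_1$ and the last edge $x_{2n} - y$ enter, so no induction along the
    path is needed. *)
Lemma beta_folds (w : A) : satisfies A (F25_identity Beta) -> folds w.
Proof.
move=> /= Ai n x y n_gt0 [x0 x2n xx x2ny].
have x01 : le (x 0 [*] x 1) w by apply: xx; lia.
pose e v := match v with
  Vx => x 0 | Vy => x 1 | Vt => x (2 * n) | _ => y end.
by apply: (le_rule (e := e) Ai); by_le.
Qed.

Lemma iota2_rule (w : A) : satisfies A (F25_identity Iota2) -> iota_rule w.
Proof.
move=> /= Ai x0 x1 x2 x3 x4 x5 *.
pose e v := match v with
  Vi 0 => x0 | Vi 1 => x1 | Vi 2 => x2 | Vi 3 => x3 | Vi 4 => x4 | _ => x5 end.
by apply: (le_rule (e := e) Ai); by_le.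
Qed.

Lemma iota2D_rule (w : A) : aboveD w -> satisfies A (F25_identity Iota2D) ->
  iota_rule w.
Proof.
move=> [t [u [tw uw tuw]]] /= Ai x0 x1 x2 x3 x4 x5 *.
pose e v := match v with
  | Vi 0 => x0 | Vi 1 => x1 | Vi 2 => x2 | Vi 3 => x3 | Vi 4 => x4
  | Vi _ => x5 | Vt => t | _ => u end.
by apply: (le_rule (e := e) Ai); by_le.
Qed.

Lemma eta_eta_rule (w : A) : satisfies A (F25_identity Eta) -> eta_rule w.
Proof.
move=> /= Ai x y z *.
pose e v := match v with Vx => x | Vy => y | _ => z end.
by apply: (le_rule (e := e) Ai); by_le.
Qed.

Lemma etaD_eta_rule (w : A) : aboveD w -> satisfies A (F25_identity EtaD) ->
  eta_rule w.
Proof.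
move=> [t [u [tw uw tuw]]] /= Ai x y z *.
pose e v := match v with Vx => x | Vy => y | Vz => z | Vt => t | _ => u end.
by apply: (le_rule (e := e) Ai); by_le.
Qed.

(** The path of $\gamma_1$ is read backwards, so that the marked vertex [b] of mu is $x_2$. *)
Lemma mu_gamma1_rule (w : A) : satisfies A (F25_identity Mu) -> gamma1_rule w.
Proof.
move=> /= Ai x0 x1 x2 y *; apply: mul_leC.
pose e v := match v with Va => y | Vb => x2 | Vc => x1 | _ => x0 end.
by apply: (le_rule (e := e) Ai); by_le.
Qed.

Lemma muD_gamma1_rule (w : A) : aboveD w -> satisfies A (F25_identity MuD) ->
  gamma1_rule w.
Proof.
move=> [t [u [tw uw tuw]]] /= Ai x0 x1 x2 y *; apply: mul_leC.
pose e v := match v with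
  Va => y | Vb => x2 | Vc => x1 | Vd => x0 | Vt => t | _ => u end.
by apply: (le_rule (e := e) Ai); by_le.
Qed.

Lemma gamma1P : satisfies A (gamma 1) <-> forall w : A, gamma1_rule w.
Proof.
split=> [/gammaP h w x0 x1 x2 y x0w x2w x01 x12 x2y | h].
  apply: (h isT (fun j => match j with 0 => x0 | 1 => x1 | _ => x2 end)).
  by split=> // -[|[|]].
apply/gammaP => // x y w [x0 x2 xx x2y].
by apply: (h w _ (x 1) (x 2)) => //; apply: xx.
Qed.

Lemma gammaD1P : satisfies A (gammaD 1) <->
  forall w : A, aboveD w -> gamma1_rule w.
Proof.
split=> [/gammaDP h w Dw x0 x1 x2 y x0w x2w x01 x12 x2y | h].
  apply: (h isT (fun j => match j with 0 => x0 | 1 => x1 | _ => x2 end)) => //.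
  by split=> // -[|[|]].
apply/gammaDP => // x y w Dw [x0 x2 xx x2y].
by apply: (h w Dw _ (x 1) (x 2)) => //; apply: xx.
Qed.

Lemma I0_folds i (w : A) : i \in I0 -> satisfies A (F25_identity i) -> folds w.
Proof.
have [->|iB] := eqVneq i Beta; first by move=> _; exact: beta_folds.
have [->|iI] := eqVneq i Iota2.
  by move=> _ Ai; exact/iota_folds/iota2_rule.
move=> iI0 Ai; apply: alpha_folds; apply: alpha_I0 Ai.
by rewrite in_setD iI0 in_set2 negb_or iB iI.
Qed.

Lemma ID_folds i (w : A) : i \in ID -> aboveD w ->
  satisfies A (F25_identity i) -> folds w.
Proof.
move=> iID Dw Ai; have [iI0|iI0] := boolP (i \in I0); first exact: I0_folds Ai.
have [iI|iI] := eqVneq i Iota2D.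
  by apply/iota_folds/iota2D_rule => //; rewrite -iI.
apply: alpha_folds; apply: alpha_ID Ai => //.
by rewrite in_setD1 iI in_setD iI0.
Qed.

End Derivations.

(** * Upper values: the identities that hold *)

Lemma U_gamma (H : {set F25}) (p q : enat) n :
  let a := emax p (Fin (Mu \in H)) in
  1 <= n ->
  ele (Fin n) (if (H :&: I0 != set0) || ((Eta \in H) && ele (Fin 1) a)
               then Inf else a) ->
  class_satisfies (U H p q) (gamma n).
Proof.
move=> a n_gt0; case: ifPn => [cond _|_ na] A [VA AH Ap Aq].
  case/orP: cond => [/set0Pn[i /setIP[iH iI0]]|/andP[etaH a1]].
    by apply: folds_gamma => // w; exact: (I0_folds VA iI0 (AH _ iH)).
  apply: folds_gamma => // w; apply: gamma1_eta_folds.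
    exact: eta_eta_rule (AH _ etaH).
  have [/AH muA|/negPf muH] := boolP (Mu \in H); first exact: mu_gamma1_rule.
  apply: (gamma1P VA).1; apply: Ap => //.
  by move: a1; rewrite /a muH; case: (p) => // [[]].
have [np|np] := boolP (ele (Fin n) p); first exact: Ap.
(* Since [n] exceeds [p], the bound can only come from mu, which forces [n] to be 1. *)
move: na; rewrite /a /emax; case: ifP => [_|_]; last by rewrite (negPf np).
case: (boolP (Mu \in H)) => /= [/AH muA|_]; last by case: n n_gt0 np.
case: n n_gt0 np => [|[|//]] // _ _ _; apply/gamma1P => // w.
exact: mu_gamma1_rule.
Qed.

Lemma U_gammaD (H : {set F25}) (p q : enat) n :
  let b := emax q (Fin (H :&: [set Mu; MuD] != set0)) in
  1 <= n ->
  ele (Fin n) (if (H :&: ID != set0)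
        || ((H :&: [set Eta; EtaD] != set0) && ele (Fin 1) b)
     then Inf else b) ->
  class_satisfies (U H p q) (gammaD n).
Proof.
move=> b n_gt0 nb A [VA AH Ap Aq].
have mu_rule (w : A) : H :&: [set Mu; MuD] != set0 -> aboveD w -> gamma1_rule w.
  case/set0Pn=> i /setIP[/AH Ai]; rewrite !inE.
  case/orP=> /eqP iE Dw; rewrite iE in Ai; first exact: mu_gamma1_rule.
  exact: muD_gamma1_rule.
move: nb; case: ifPn => [cond _|_].
  case/orP: cond => [/set0Pn[i /setIP[iH iID]]|/andP[etaH b1]].
    by apply: folds_gammaD => // w Dw; exact: (ID_folds VA iID Dw (AH _ iH)).
  apply: folds_gammaD => // w Dw; apply: gamma1_eta_folds.
    case/set0Pn: etaH => i /setIP[/AH Ai]; rewrite !inE.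
    case/orP=> /eqP iE; rewrite iE in Ai; first exact: eta_eta_rule.
    exact: etaD_eta_rule.
  have [|/negPf muH] := boolP (H :&: [set Mu; MuD] != set0).
    by move/mu_rule; apply.
  apply: (gammaD1P VA).1 => //; apply: Aq => //.
  by move: b1; rewrite /b muH; case: (q) => // [[]].
have [nq _|nq] := boolP (ele (Fin n) q); first exact: Aq.
rewrite /b /emax; case: ifP => [_|_]; last by rewrite (negPf nq).
case: (boolP (_ != set0)) => /= [muH|_]; last by case: n n_gt0 nq.
case: n n_gt0 nq => [|[|//]] // _ _ _; apply/gammaD1P => // w.
exact: mu_rule.
Qed.

(** * Quotients of the term algebra *)

Fixpoint subst (s : var -> term) (t : term) : term :=
  match t with
  | Var v => s v
  | Add t1 t2 => Add (subst s t1) (subst s t2)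
  | Mul t1 t2 => Mul (subst s t1) (subst s t2)
  end.

Lemma eval_subst (A : algebra) (e : var -> A) s t :
  eval e (subst s t) = eval (fun v => eval e (s v)) t.
Proof. by elim: t => //= t1 -> t2 ->. Qed.

Section Quotient.

Variables (G : algebra) (R : term -> term -> Prop).
Hypothesis R_sym : forall s t, R s t -> R t s.
Hypothesis R_trans : forall s t r, R s t -> R t r -> R s r.
Hypothesis R_add :
  forall s s' t t', R s s' -> R t t' -> R (s + t)%T (s' + t')%T.
Hypothesis R_mul :
  forall s s' t t', R s s' -> R t t' -> R (s * t)%T (s' * t')%T.
Hypothesis R_eq : forall s t, satisfies G (s ≈ t) -> R s t.

Let carrier := {P : term -> Prop | exists t, P = R t}.

Definition term_class (t : term) : carrier :=
  exist _ (R t) (ex_intro _ t erefl).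

Let repr (P : carrier) : term := projT1 (boolp.cid (proj2_sig P)).

Let R_refl t : R t t. Proof. exact: R_eq. Qed.

Let term_class_eq s t : term_class s = term_class t <-> R s t.
Proof.
split=> [[E]|Rst]; first by rewrite E; exact: R_refl.
apply: boolp.eq_exist; apply: boolp.funext => r; apply: boolp.propext.
by split; apply: R_trans => //; exact: R_sym.
Qed.

Let reprK P : term_class (repr P) = P.
Proof.
by case: P => P hP; apply: boolp.eq_exist; rewrite /repr; case: boolp.cid.
Qed.

Let R_repr t : R (repr (term_class t)) t.
Proof. by apply/term_class_eq; exact: reprK. Qed.

Definition quotient : algebra := @Algebra carrier
  (fun P Q => term_class (repr P + repr Q)%T)
  (fun P Q => term_class (repr P * repr Q)%T).

Let eval_quotient (s : var -> term) t :
  eval (fun v => term_class (s v) : quotient) t = term_class (subst s t).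
Proof.
by elim: t => //= t1 -> t2 ->; apply/term_class_eq;
  [apply: R_add | apply: R_mul]; exact: R_repr.
Qed.

(** An assignment into the quotient lifts to a substitution by representatives, so [R] itself need
    not be closed under substitution. *)
Lemma quotient_satisfies u v :
  satisfies quotient (u ≈ v) <-> forall s, R (subst s u) (subst s v).
Proof.
split=> [E s|h e].
  by apply/term_class_eq; rewrite -!eval_quotient; exact: E.
have -> : e = fun x => term_class (repr (e x)).
  by apply: boolp.funext => x; rewrite reprK.
by rewrite !eval_quotient; apply/term_class_eq.
Qed.

(* The quotient is an image of the free algebra, which consists of the term
   functions and hence embeds into a power of [G]. *)
Lemma quotient_variety : variety_gen G quotient.
Proof.
pose F := {f : (var -> G) -> G | exists t, f = fun e => eval e t}.
pose cls t : F := exist _ (fun e => eval e t) (ex_intro _ t erefl).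
pose rep (f : F) : term := projT1 (boolp.cid (proj2_sig f)).
have repE f : proj1_sig f = fun e => eval e (rep f).
  by rewrite /rep; case: boolp.cid.
have rep_cls t : R (rep (cls t)) t.
  by apply: R_eq => e; have /= := congr1 (fun f => f e) (repE (cls t)).
pose free := @Algebra F (fun f g => cls (rep f + rep g)%T)
  (fun f g => cls (rep f * rep g)%T).
apply: (@vg_hom _ free _ (fun f : free => term_class (rep f) : quotient)).
- split=> f g; apply/term_class_eq; apply: R_trans (rep_cls _) _.
  + by apply: R_add; exact/R_sym/R_repr.
  + by apply: R_mul; exact/R_sym/R_repr.
- move=> P; exists (cls (repr P)); rewrite -[RHS]reprK.
  by apply/term_class_eq; exact: rep_cls.
apply: (@vg_sub _ free (prod_algebra (fun _ : var -> G => G))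
  (@proj1_sig _ _)); last by apply: vg_prod => _; exact: vg_base.
- exact: (inhabits (cls (Var Va))).
- by split=> f g; rewrite [in RHS](repE f) [in RHS](repE g).
- by case=> f hf [g hg] /= E; exact: boolp.eq_exist.
Qed.

End Quotient.

(** * The syntactic quotient of a set of assignments *)

Fixpoint linear (t : term) : bool :=
  match t with
  | Var _ => true
  | Add t1 t2 => linear t1 && linear t2
  | Mul _ _ => false
  end.

Fixpoint occurs (v : var) (t : term) : Prop :=
  match t with
  | Var x => v = x
  | Add t1 t2 | Mul t1 t2 => occurs v t1 \/ occurs v t2
  end.

Lemma occurs_ex t : exists v, occurs v t.
Proof.
by elim: t => [v|t1 [v h] t2 _|t1 [v h] t2 _]; exists v => //=; left.
Qed.

Lemma linear_subst s t : linear (subst s t) -> linear t.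
Proof. by elim: t => //= t1 IH1 t2 IH2 /andP[/IH1-> /IH2->]. Qed.

Section SyntacticQuotient.

Variable h : (var -> R12) -> Prop.
Hypothesis h_ex : exists e, h e.

Definition below (t : term) : Prop := forall e, h e -> le (eval e t) (rc : R12).

(* Multiplying by sums of variables reduces to [Var v] by distributivity, and
   products of higher degree are never below c, so these contexts suffice. *)
Definition context_eq (s t : term) : Prop := (below s <-> below t) /\
  forall v, below (s * Var v)%T <-> below (t * Var v)%T.

Lemma below_add s t : below (s + t)%T <-> below s /\ below t.
Proof.
have E (x y : R12) : le (x [+] y) (rc : R12) <->
    le x (rc : R12) /\ le y (rc : R12).
  by rewrite /le; case: x; case: y; split=> // [[]].
split=> [st|[hs ht] e he]; last by apply/E; split; [exact: hs | exact: ht].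
by split=> e /st /E [].
Qed.

Lemma below_mulC s t : below (s * t)%T -> below (t * s)%T.
Proof.
move=> st e /st; have -> // : eval e (s * t)%T = eval e (t * s)%T.
by rewrite /=; case: (eval e s); case: (eval e t).
Qed.

Lemma below_mulDr s t r :
  below (s * (t + r))%T <-> below (s * t)%T /\ below (s * r)%T.
Proof.
rewrite -below_add; split=> b e /b; congr (le _ _) => /=;
  by case: (eval e s); case: (eval e t); case: (eval e r).
Qed.

Lemma below_mulDl s t r :
  below ((s + t) * r)%T <-> below (s * r)%T /\ below (t * r)%T.
Proof.
split=> [/below_mulC/below_mulDr[/below_mulC sr /below_mulC tr] // |[]].
by move=> /below_mulC sr /below_mulC tr; apply/below_mulC/below_mulDr.
Qed.

(* Products of degree three vanish in [R12]. *)
Lemma below_linear s t : below (s * t)%T -> linear t.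
Proof.
elim: t => //= [t1 IH1 t2 IH2 /below_mulDr[/IH1-> /IH2->] //|t1 _ t2 _].
have [e he] := h_ex; move=> /(_ e he) /=.
by case: (eval e s); case: (eval e t1); case: (eval e t2).
Qed.

Lemma below_nonlinear s t : ~~ linear s -> ~ below (s * t)%T.
Proof. by move=> /negP sl /below_mulC/below_linear. Qed.

Lemma below_mulr s t : below (s * t)%T <->
  linear t /\ forall v, occurs v t -> below (s * Var v)%T.
Proof.
split=> [st|].
  split; first exact: below_linear st.
  elim: t st => [v st _ -> //|t1 IH1 t2 IH2|t1 _ t2 _ /below_linear//].
  by case/below_mulDr=> /IH1 h1 /IH2 h2 v [/h1|/h2].
elim: t => [v [_]|t1 IH1 t2 IH2 /= [/andP[l1 l2] occ]|t1 _ t2 _ [] //].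
  exact.
by apply/below_mulDr; split; [apply: IH1|apply: IH2]; split=> // v hv;
  apply: occ; [left | right].
Qed.

(** By distributivity a product of sums of variables is the sum of the products of its variables; a
    factor containing a product makes the value 0. *)
Lemma below_mul s t : below (s * t)%T <-> [/\ linear s, linear t &
  forall u v, occurs u s -> occurs v t -> below (Var u * Var v)%T].
Proof.
split=> [st|[ls lt occ]].
  split; [exact: below_linear (below_mulC st) | exact: below_linear st |].
  move=> u v us vt; have [_ /(_ v vt) sv] := (below_mulr s t).1 st.
  by apply: below_mulC; have [_] := (below_mulr _ s).1 (below_mulC sv); apply.
apply/below_mulr; split=> // v vt; apply/below_mulC/below_mulr.
by split=> // u us; apply/below_mulC/occ.
Qed.

Lemma below_lin t : linear t ->
  below t <-> forall v, occurs v t -> below (Var v).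
Proof.
elim: t => // [v _|t1 IH1 t2 IH2 /= /andP[/IH1 h1 /IH2 h2]].
  by split=> [b _ -> //|]; apply.
rewrite below_add h1 h2; split=> [[b1 b2] v [/b1|/b2] //|b].
by split=> v hv; apply: b; [left | right].
Qed.

Lemma context_eq_sym s t : context_eq s t -> context_eq t s.
Proof. by case=> st sv; split=> [|v]; [rewrite st | rewrite sv]. Qed.

Lemma context_eq_trans s t r :
  context_eq s t -> context_eq t r -> context_eq s r.
Proof. by case=> st sv [tr tv]; split=> [|v]; [rewrite st | rewrite sv]. Qed.

Lemma context_eq_add s s' t t' : context_eq s s' -> context_eq t t' ->
  context_eq (s + t)%T (s' + t')%T.
Proof.
case=> ss sv [tt tv]; split=> [|v]; first by rewrite !below_add ss tt.
by rewrite !below_mulDl sv tv.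
Qed.

(** A product multiplied by a variable is never below c, so only the product itself has to be
    compared; its factors are exchanged one at a time. *)
Lemma context_eq_mul s s' t t' : context_eq s s' -> context_eq t t' ->
  context_eq (s * t)%T (s' * t')%T.
Proof.
have mulr r r' u : context_eq r r' -> below (r * u)%T -> below (r' * u)%T.
  case=> _ rv /below_mulr[lu occ]; apply/below_mulr; split=> // v /occ.
  by rewrite rv.
move=> ss tt; split=> [|v]; last by split=> /below_nonlinear; case.
split.
- by move=> /(mulr _ _ _ ss)/below_mulC/(mulr _ _ _ tt)/below_mulC.
- move=> /(mulr _ _ _ (context_eq_sym ss))/below_mulC.
  by move=> /(mulr _ _ _ (context_eq_sym tt))/below_mulC.
Qed.

Lemma context_eq_R12 s t : satisfies R12 (s ≈ t) -> context_eq s t.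
Proof.
move=> st; have E (e : var -> R12) : eval e s = eval e t by exact: st.
by split=> [|v]; split=> b e he; have := b e he; rewrite /= E.
Qed.

Definition syntactic : algebra := quotient context_eq.

Lemma syntactic_variety : variety_gen R12 syntactic.
Proof.
exact: quotient_variety context_eq_sym context_eq_trans context_eq_add
  context_eq_mul context_eq_R12.
Qed.

Lemma syntactic_satisfies u v : satisfies syntactic (u ≈ v) <->
  forall s, context_eq (subst s u) (subst s v).
Proof.
exact: quotient_satisfies context_eq_sym context_eq_trans context_eq_add
  context_eq_mul context_eq_R12 u v.
Qed.

(** As [v] contains a product, it is never below c in a multiplicative context. The identity thus
    becomes an implication between terms below c. *)
Lemma syntactic_le u v : ~~ linear v -> satisfies syntactic (u ⪯ v) <->
  forall s, below (subst s v) -> below (subst s u).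
Proof.
move=> nv; rewrite syntactic_satisfies; split=> [uv s|uv s].
  by have [E _] := uv s; rewrite -E /= below_add => -[].
split=> [|x] /=.
  by rewrite below_add; split=> [[]//|b]; split=> //; exact: uv.
have nvs : ~~ linear (subst s v) by apply: contra nv; exact: linear_subst.
by split=> /below_nonlinear []; rewrite //= negb_and nvs orbT.
Qed.

End SyntacticQuotient.

(** * Marked paths *)

Section MarkedPath.

Variables (K : nat) (mk : pred nat) (wt : bool).
Hypothesis mk_even : forall j, mk j -> ~~ odd j.

(* The graph is the path x_0 - ... - x_K with marks [mk], together with, when
   [wt] holds, an edge t - u with both ends marked. *)
Definition mark (v : var) : bool :=
  match v with
  | Vi j => (j <= K) && mk j
  | Vt | Vu => wt
  | _ => false
  end.

Definition edge (u v : var) : bool :=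
  match u, v with
  | Vi i, Vi j => [&& i <= K, j <= K & (i.+1 == j) || (j.+1 == i)]
  | Vt, Vu | Vu, Vt => wt
  | _, _ => false
  end.

(* [path_env (Some i) s] puts q at x_(2i) and p at all odd vertices that are
   not adjacent to it (an index beyond [K] puts p at all odd vertices);
   [path_env None s] puts p at all unmarked even vertices. *)
Definition path_env (o : option nat) (s : bool) (v : var) : R12 :=
  match v with
  | Vi j =>
    if K < j then r0 else
    match o with
    | None => if odd j then rb else if mk j then ra else rp
    | Some i =>
      if odd j then if (j == (2 * i).+1) || (j.+1 == 2 * i) then ra else rp
      else if j == 2 * i then rq else rb
    end
  | Vt => if wt then if s then ra else rb else r0
  | Vu => if wt then if s then rb else ra else r0
  | _ => r0
  end.

Definition path_envs (e : var -> R12) : Prop := exists o s, e = path_env o s.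

Lemma path_envs_ex : exists e, path_envs e.
Proof. by exists (path_env None true), None, true. Qed.

Local Notation below := (below path_envs).

Lemma belowP t :
  below t <-> forall o s, le (eval (path_env o s) t) (rc : R12).
Proof.
split=> [b o s|b _ [o [s ->]]]; last exact: b.
by apply: b; exists o, s.
Qed.

Lemma below_markP v : below (Var v) <-> mark v.
Proof.
rewrite belowP; split=> [b|].
  (* Under [None] the unmarked even vertices take the value p; under the index [K.+1], whose double
     is beyond the path, all odd vertices do. The element p is not below c. *)
  have b0 := b None true; have b1 := b (Some K.+1) true.
  move: b0 b1; rewrite /le /=; case: v {b} => //=; try by case: wt.
  move=> j; case: ltnP => //= jK; case: (mk j) => //; case: (odd j) => //.
  by case: eqP => [|_] //=; [lia | case: eqP => [|_] //=; lia].
case: v => //=; try by move=> -> o [].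
move=> j /andP[jK mj] o s; rewrite ltnNge jK /= (negPf (mk_even mj)) mj.
by case: o => [i|] //; case: ifP.
Qed.

Lemma below_edgeP u v : below (Var u * Var v)%T <-> edge u v.
Proof.
have step i o s : i < K ->
    le (path_env o s (Vi i) [*] path_env o s (Vi i.+1)) (rc : R12).
  move=> iK; rewrite /le /=.
  have -> : (K < i) = false by lia.
  have -> : (K < i.+1) = false by lia.
  case: o => [k|]; case: (odd i) => /=; try by case: ifP.
    case: (boolP (i.+1 == 2 * k)) => [_|ik]; first by rewrite orbT.
    by case: ifP.
  case: (boolP (i == 2 * k)) => [/eqP->|ik]; first by rewrite eqxx.
  by case: ifP.
split=> [b|].
  have sep o s : le (path_env o s u [*] path_env o s v) (rc : R12).
    by have /belowP := b; apply.
  have half k : ~~ odd k -> 2 * k./2 = k by lia.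
  (* Both orientations of t - u are used: the value at t or u is once a and once b, and one of the
     two has product 0 with the value at a given path vertex. *)
  have b0 := sep None true; have b1 := sep None false.
  move: b0 b1; rewrite /le; case: u b sep => //=; case: v => //=;
    try by [case: wt |
            move=> j _ _; case: wt; case: (K < j); case: odd; case: mk].
  move=> j i _ sep b0 _; move: b0.
  (* For vertices of opposite parity one of these indices puts q at the even one, and then the odd
     one avoids p only if it is adjacent. Vertices of equal parity are separated by [None]. *)
  have := sep (Some i./2) true; have := sep (Some j./2) true; rewrite /le /=.
  case: (ltnP K i) => //= iK; case: (ltnP K j) => //= jK.
    by case: odd => //; case: ifP => //; case: ifP.
  case: (boolP (odd i)) => oi; case: (boolP (odd j)) => oj=> //.
  - by rewrite half // eqxx orbC [_ == j.+1]eq_sym; case: ifP.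
  - move=> _; rewrite half // eqxx ![_ == i.+1]eq_sym.
    by case: ifP.
  - by case: (mk i); case: (mk j).
have stepB i : i < K -> below (Var (Vi i) * Var (Vi i.+1))%T.
  by move=> iK; apply/belowP => o s; exact: step.
case: u; case: v => //=;
  try by move=> wt1; apply/belowP; rewrite /= wt1 => o [].
by move=> j i /and3P[iK jK /orP[] /eqP E]; move: iK jK; rewrite -E => iK jK;
  [|apply: below_mulC]; exact: stepB.
Qed.

Lemma edge_sym u v : edge u v = edge v u.
Proof.
by case: u; case: v => //= j i; rewrite orbC andbA [(i <= K) && _]andbC -andbA.
Qed.

(** Marks on the path sit at even vertices, so an edge with two marked ends is t - u, which is a
    component of its own. *)
Lemma marked_edge_neighbor u v w :
  mark u -> mark v -> edge u v -> edge v w -> w = u.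
Proof.
case: u; case: v => //=; try by case: w.
move=> j i /andP[_ /mk_even oi] /andP[_ /mk_even oj] /and3P[_ _]; lia.
Qed.

Lemma below_edges s t : below (s * t)%T <-> [/\ linear s, linear t &
  forall u v, occurs u s -> occurs v t -> edge u v].
Proof.
by rewrite (below_mul path_envs_ex); split=> -[ls lt occ]; split=> // u v us vt;
  apply/below_edgeP; exact: occ.
Qed.

Lemma below_marks s u : linear s -> below s -> occurs u s -> mark u.
Proof. by move=> /below_lin sl /sl h /h /below_markP. Qed.

Definition path_model : algebra := syntactic path_envs.

Lemma path_model_variety : variety_gen R12 path_model.
Proof. exact: syntactic_variety path_envs_ex. Qed.

Let model_le u v : ~~ linear v -> satisfies path_model (u ⪯ v) <->
  forall s, below (subst s v) -> below (subst s u).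
Proof. exact: syntactic_le path_envs_ex u v. Qed.

Lemma marked_edge_swap a b c d : below a -> below b -> below (a * b)%T ->
  below (b * c)%T -> below (c * d)%T <-> below (a * d)%T.
Proof.
move=> ba bb /below_edges[la lb ab] /below_edges[_ lc bc].
have [a0 ha] := occurs_ex a; have [b0 hb] := occurs_ex b.
have [c0 hc] := occurs_ex c.
have ca u v : occurs u a -> occurs v c -> v = u.
  move=> ua vc; exact: (marked_edge_neighbor (below_marks la ba ua)
    (below_marks lb bb hb) (ab _ _ ua hb) (bc _ _ hb vc)).
split=> /below_edges[_ ld E]; apply/below_edges; split=> // u v hu hv.
  by rewrite -(ca u c0) //; exact: E.
by rewrite (ca a0 u) //; exact: E.
Qed.

(** What remains is lambda, mu_2, epsilon and kappa. The right-hand side of each contains an edge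
    with both ends marked, hence the isolated edge t - u. *)
Lemma path_model_nID i : i \notin ID -> i \notin [set Eta; EtaD; Mu; MuD] ->
  satisfies path_model (F25_identity i).
Proof.
case: i; rewrite !inE //= => _ _; apply/model_le => // s /=;
  rewrite !below_add.
- case=> -[[bx by_] xy] xz.
  have /below_edges[lx ly xyE] := xy; have /below_edges[_ lz xzE] := xz.
  have [x0 hx] := occurs_ex (s Vx); have [y0 hy] := occurs_ex (s Vy).
  apply/below_lin => // v hv; apply/below_markP.
  have yx : edge y0 x0 by rewrite edge_sym; exact: xyE.
  have my := below_marks ly by_ hy.
  by rewrite (marked_edge_neighbor my (below_marks lx bx hx) yx
    (xzE _ _ hx hv)).
- case=> -[bb bc] [[ab bc'] cd].
  by apply/(marked_edge_swap _ bc bb (below_mulC bc') (below_mulC ab)).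
- case=> -[[ba bb] bc] [[ab bc'] cd].
  by apply/(marked_edge_swap _ ba bb ab bc').
- case=> -[ba bb] [[ab bc'] cd].
  by apply/(marked_edge_swap _ ba bb ab bc').
Qed.

Lemma path_model_Mu : satisfies path_model (F25_identity Mu) ->
  satisfies path_model (F25_identity MuD).
Proof.
move=> /(@model_le (Var Va * Var Vd)%T) /= h; apply/model_le => // s /=.
by rewrite !below_add => -[bL _]; apply: h => //; rewrite /= !below_add.
Qed.

Lemma path_model_Eta : satisfies path_model (F25_identity Eta) ->
  satisfies path_model (F25_identity EtaD).
Proof.
move=> /(@model_le (Var Vz)) /= h; apply/model_le => // s /=.
by rewrite !below_add => -[bL _]; apply: h => //; rewrite /= !below_add.
Qed.

Lemma eta_path_model :
  (forall u v w, mark u -> edge u v -> edge v w -> mark w) ->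
  satisfies path_model (F25_identity Eta).
Proof.
move=> mkw; apply/model_le => // s /=.
rewrite !below_add => -[[bx /below_edges[lx ly xy]] /below_edges[_ lz yz]].
have [x0 hx] := occurs_ex (s Vx); have [y0 hy] := occurs_ex (s Vy).
apply/below_lin => // w hw; apply/below_markP.
exact: mkw (below_marks lx bx hx) (xy _ _ hx hy) (yz _ _ hy hw).
Qed.

Lemma mu_path_model :
  (forall u v w, mark v -> edge u v -> edge v w -> u = w) ->
  satisfies path_model (F25_identity Mu).
Proof.
move=> ew; apply/model_le => // s /=; rewrite !below_add.
case=> bb [[/below_edges[la lb ab] /below_edges[_ lc bc]]].
move=> /below_edges[_ ld cd].
have [b0 hb] := occurs_ex (s Vb); have [c0 hc] := occurs_ex (s Vc).
apply/below_edges; split=> // u v hu hv.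
by rewrite (ew u b0 c0 (below_marks lb bb hb) (ab _ _ hu hb) (bc _ _ hb hc));
  exact: cd.
Qed.

Lemma below_gamma_rhs s n : 0 < n -> below (subst s (gamma_rhs n)) <->
  [/\ below (s (Vi 0)), below (s (Vi (2 * n))),
    forall j, j < 2 * n -> below (s (Vi j) * s (Vi j.+1))%T &
    below (s (Vi (2 * n)) * s Vy)%T].
Proof.
move=> n0; have E e : le (eval e (subst s (gamma_rhs n))) (rc : R12) <->
    chain n (fun j => eval e (s (Vi j))) (eval e (s Vy)) (rc : R12).
  by rewrite eval_subst; exact: (gamma_rhs_le (vg_base R12)).
split=> [b|[b0 b1 b2 b3] e he].
  by split=> [||j jn|] e /b /E [? ? h ?] //; exact: h.
by apply/E; split=> [||j jn|]; [apply: b0|apply: b1|apply: b2|apply: b3].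
Qed.

Let gamma_rhs_nonlinear n : ~~ linear (gamma_rhs n).
Proof. by rewrite /= andbF. Qed.

Lemma gamma_path_model n : 0 < n ->
  (forall x : nat -> var, mark (x 0) -> mark (x (2 * n)) ->
    (forall j, j < 2 * n -> edge (x j) (x j.+1)) -> x 0 = x (2 * n)) ->
  satisfies path_model (gamma n).
Proof.
move=> n0 walk; apply/model_le; first exact: gamma_rhs_nonlinear.
move=> s /(below_gamma_rhs _ n0)[b0 b1 b2 b3].
have /below_edges[l1 ly yE] := b3.
have lin j : j < 2 * n -> linear (s (Vi j)).
  by move=> /b2/below_edges[].
have l0 : linear (s (Vi 0)) by apply: lin; lia.
have [x xP] := boolp.choice (fun j => occurs_ex (s (Vi j))).
apply/below_edges; split=> // u v hu hv.
(* The walk starts at the given variable [u] instead of the chosen one, since every variable of the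
   term at $x_0$ must be shown adjacent to [y]. *)
pose x' j := if j is j'.+1 then x j else u.
have x'P j : occurs (x' j) (s (Vi j)) by case: j => [|j] /=; [| exact: xP].
have -> : u = x' (2 * n).
  apply: (walk x').
  - exact: below_marks (x'P 0).
  - exact: below_marks (x'P _).
  - by move=> j /b2/below_edges[_ _]; apply; exact: x'P.
exact: yE.
Qed.

Definition walk_subst (x : nat -> var) (y v : var) : term :=
  Var match v with Vi j => x j | Vy => y | _ => v end.

Lemma below_walk n x y : 0 < n -> mark (x 0) -> mark (x (2 * n)) ->
  (forall j, j < 2 * n -> edge (x j) (x j.+1)) -> edge (x (2 * n)) y ->
  below (subst (walk_subst x y) (gamma_rhs n)).
Proof.
move=> n0 m0 m1 xx xy; apply/below_gamma_rhs => //.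
split=> [||j jn|]; [exact/below_markP|exact/below_markP| |exact/below_edgeP].
by apply/below_edgeP; exact: xx.
Qed.

Lemma path_model_ngamma n x y : 0 < n -> mark (x 0) -> mark (x (2 * n)) ->
  (forall j, j < 2 * n -> edge (x j) (x j.+1)) -> edge (x (2 * n)) y ->
  ~~ edge (x 0) y -> ~ satisfies path_model (gamma n).
Proof.
move=> n0 m0 m1 xx xy /negP nxy.
move=> /(@model_le (Var (Vi 0) * Var Vy)%T) h; apply: nxy.
have nl := gamma_rhs_nonlinear n.
have /below_edges[_ _] := h nl (walk_subst x y) (below_walk n0 m0 m1 xx xy).
by apply.
Qed.

(** [walk_subst] fixes t and u, so $D(t,u)$ stays below c by the marked edge t - u. *)
Lemma path_model_ngammaD n x y : wt -> 0 < n -> mark (x 0) ->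
  mark (x (2 * n)) ->
  (forall j, j < 2 * n -> edge (x j) (x j.+1)) -> edge (x (2 * n)) y ->
  ~~ edge (x 0) y -> ~ satisfies path_model (gammaD n).
Proof.
move=> wt1 n0 m0 m1 xx xy /negP nxy.
move=> /(@model_le (Var (Vi 0) * Var Vy)%T) h; apply: nxy.
have bw := below_walk n0 m0 m1 xx xy.
have /below_edges[_ _] : below (subst (walk_subst x y) (Var (Vi 0) * Var Vy)%T).
  apply: h; first by rewrite /= andbF.
  suff: below (subst (walk_subst x y) (gamma_rhs n) +
               subst (walk_subst x y) (Dterm (Var Vt) (Var Vu)))%T by [].
  apply/below_add; split=> //=; rewrite !below_add.
  by do !split; first [exact/below_markP | exact/below_edgeP].
by apply.
Qed.

Hypothesis no_tu : ~~ wt.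

(** Without t - u all marked vertices are even vertices of the path, and no two of them are
    adjacent. Identities with a summand $D$ on the right then hold vacuously. *)
Lemma below_D t u : below t -> below u -> ~ below (t * u)%T.
Proof.
move=> bt bu /below_edges[lt lu tu].
have [t0 ht] := occurs_ex t; have [u0 hu] := occurs_ex u.
have := below_marks lt bt ht; have := below_marks lu bu hu.
have := tu _ _ ht hu; case: t0 {ht} => //=; case: u0 {hu} => //=;
  rewrite ?(negPf no_tu) // => j i /and3P[_ _ ij] /andP[_ /mk_even oj].
by case/andP=> _ /mk_even oi; lia.
Qed.

Lemma path_model_D u v t r : satisfies path_model (u ⪯ v + Dterm t r).
Proof.
apply/model_le => [|s /=]; first by rewrite /= !andbF.
by rewrite !below_add => -[_ [[bt br] /(below_D bt br)]].
Qed.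

Lemma path_model_nI0 i : i \notin I0 ->
  (i = Eta -> satisfies path_model (F25_identity Eta)) ->
  (i = Mu -> satisfies path_model (F25_identity Mu)) ->
  satisfies path_model (F25_identity i).
Proof.
move=> iI0 iEta iMu.
have [iN|] := boolP (i \notin ID :|: [set Eta; EtaD; Mu; MuD]).
  by move: iN; rewrite in_setU negb_or => /andP[]; exact: path_model_nID.
case: i iI0 iEta iMu; rewrite !inE => //= _ iEta iMu _;
  try by [apply: iEta | apply: iMu | exact: path_model_D].
- apply/model_le => // s /=; rewrite !below_add.
  by case=> -[[bx by_] /(below_D bx by_)].
(* For xi neither side is ever below c: the graph has no loops, and [below_D] excludes $D(x,y)$. *)
- apply/(syntactic_satisfies path_envs_ex) => s; split=> [|v] /=.
    split=> [|]; last by rewrite !below_add => -[[bx by_] /(below_D bx by_)].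
    case/below_edges=> _ _ xx; have [x0 hx] := occurs_ex (s Vx).
    have := xx _ _ hx hx; case: (x0) => //= j /and3P[_ _]; lia.
  by split=> /(below_nonlinear path_envs_ex) []; rewrite //= andbF.
Qed.

End MarkedPath.

(** * The short path: eta holds and every gamma fails *)

Section ShortPath.

Variable wt : bool.

(* The path x_0 - x_1 - x_2 - x_3 of gamma_1, with x_3 in the role of y. *)
Definition short_marks : pred nat := [pred j | (j == 0) || (j == 2)].

Lemma short_marks_even j : short_marks j -> ~~ odd j.
Proof. by case/orP=> /eqP->. Qed.

Definition short_model := path_model 3 short_marks wt.

(** The marked vertices 0 and 2 are all the even vertices of the path, so marks are inherited at
    distance two. *)
Lemma short_model_eta : satisfies short_model (F25_identity Eta).
Proof.
apply: (eta_path_model short_marks_even) => u v w.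
case: u; case: v; case: w => //= k j i /andP[i3 mi].
move=> /and3P[_ j3 ij] /and3P[_ k3 jk].
by rewrite /short_marks /= in mi *; lia.
Qed.

(** The walk oscillates between $x_0$ and $x_1$ and moves to $x_2$ only at its last step, so one
    model refutes every $\gamma_n$. *)
Definition short_walk n j := Vi (if j == 2 * n then 2 else odd j).

Lemma short_walkP n : 0 < n ->
  [/\ mark 3 short_marks wt (short_walk n 0),
      mark 3 short_marks wt (short_walk n (2 * n)),
      forall j, j < 2 * n -> edge 3 wt (short_walk n j) (short_walk n j.+1),
      edge 3 wt (short_walk n (2 * n)) (Vi 3) &
      ~~ edge 3 wt (short_walk n 0) (Vi 3)].
Proof.
move=> n0; rewrite /short_walk eqxx.
have -> : (0 == 2 * n) = false by lia.
split=> // j jn /=; rewrite (ltn_eqF jn).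
by case: eqP => [E|_]; case: (boolP (odd j)) => //= oj; lia.
Qed.

Lemma short_model_ngamma n : 0 < n -> ~ satisfies short_model (gamma n).
Proof.
move=> n0; have [m0 m1 xx xy nxy] := short_walkP n0.
exact: (path_model_ngamma short_marks_even n0 m0 m1 xx xy nxy).
Qed.

Lemma short_model_ngammaD n : wt -> 0 < n -> ~ satisfies short_model (gammaD n).
Proof.
move=> wt1 n0; have [m0 m1 xx xy nxy] := short_walkP n0.
exact: (path_model_ngammaD short_marks_even wt1 n0 m0 m1 xx xy nxy).
Qed.

End ShortPath.

(** * The long path: mu and the shorter gammas hold *)

Section LongPath.

Variables (n : nat) (wt : bool).
Hypothesis n_gt1 : 1 < n.

Definition end_marks : pred nat := [pred j | (j == 0) || (j == 2 * n)].

Lemma end_marks_even j : end_marks j -> ~~ odd j.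
Proof. by case/orP=> /eqP->; rewrite ?oddM. Qed.

Definition long_model := path_model (2 * n) end_marks wt.

Let markn := mark (2 * n) end_marks wt.
Let edgen := edge (2 * n) wt.

(* In [long_model] the two neighbours of x_2n in gamma_n, namely x_(2n-1)
   and y, are identified, as [Mu] forces their neighbourhoods to agree. *)
Lemma long_model_mu : satisfies long_model (F25_identity Mu).
Proof.
apply: (mu_path_model end_marks_even) => u v w.
case: v => //=; [by case: u; case: w|by case: u; case: w|].
move=> j /andP[_ mj]; case: u; case: w => //= k i.
move=> /and3P[ik jk ij] /and3P[_ kk jk'].
by congr Vi; rewrite /end_marks /= in mj; lia.
Qed.

Lemma long_walk m (x : nat -> var) :
  (forall j, j < m -> edgen (x j) (x j.+1)) ->
  match x 0 with
  | Vi i => exists2 k, x m = Vi k & (k <= i + m) && (i <= k + m)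
  | Vt => x m = if odd m then Vu else Vt
  | Vu => x m = if odd m then Vt else Vu
  | _ => True
  end.
Proof.
elim: m => [_|m IHm xx]; first by case: (x 0) => // i; exists i => //; lia.
have /IHm := (fun j (jm : j < m) => xx j (ltnW jm)).
have {xx IHm} := xx m (ltnSn m).
case: (x 0) => //= [||i]; try by move=> E xm; move: E; rewrite xm; 
  case: (odd m) => /=; case: (x m.+1).
move=> E [k xm ki]; move: E; rewrite xm; case: (x m.+1) => //= k'.
move=> /and3P[_ _ kk].
by exists k' => //; lia.
Qed.

(** The two marked ends are $2n$ apart, so a walk of $2m$ steps with $m < n$ cannot join them; on t
    - u a walk of even length is closed. *)
Lemma long_model_gamma m : 0 < m -> m < n -> satisfies long_model (gamma m).
Proof.
move=> m0 mn; apply: (gamma_path_model end_marks_even) => // x mk0 mk1.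
move=> /long_walk; case: (x 0) mk0 => //= [_->|_->|i /andP[_ mi]];
  rewrite ?oddM //.
case=> k xk; move: mk1; rewrite xk /= => /andP[_].
by rewrite /end_marks /= in mi * => mk ki; congr Vi; lia.
Qed.

(** The role of [y] is played by $x_{2n-1}$, which is not adjacent to $x_0$ because $n > 1$. *)
Lemma long_walkP :
  [/\ markn (Vi 0), markn (Vi (2 * n)),
      forall j, j < 2 * n -> edgen (Vi j) (Vi j.+1),
      edgen (Vi (2 * n)) (Vi (2 * n).-1) & ~~ edgen (Vi 0) (Vi (2 * n).-1)].
Proof. by rewrite /markn /edgen /end_marks /=; split=> *; lia. Qed.

Lemma long_model_ngamma : ~ satisfies long_model (gamma n).
Proof.
have [m0 m1 xx xy nxy] := long_walkP.
exact: (path_model_ngamma end_marks_even (ltnW n_gt1) m0 m1 xx xy nxy).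
Qed.

Lemma long_model_ngammaD : wt -> ~ satisfies long_model (gammaD n).
Proof.
move=> wt1; have [m0 m1 xx xy nxy] := long_walkP.
exact: (path_model_ngammaD end_marks_even wt1 (ltnW n_gt1) m0 m1 xx xy nxy).
Qed.

End LongPath.

(** * The thresholds *)

Lemma setI_eq0_notin (T : finType) (A B : {set T}) i :
  A :&: B = set0 -> i \in A -> i \notin B.
Proof.
move=> AB iA; apply: contra_eqN AB => iB.
by apply/set0Pn; exists i; rewrite inE iA.
Qed.

Lemma ele_max m x y : ele (Fin m) (emax x y) = ele (Fin m) x || ele (Fin m) y.
Proof.
by case: x; case: y => *; rewrite /emax /= ?orbT //; case: ifP => /=; lia.
Qed.

Lemma ele_trans n x y : ele (Fin n) x -> ele x y -> ele (Fin n) y.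
Proof. by case: x; case: y => //= i j; exact: leq_trans. Qed.

(** If $a \ge 1$, then eta is not in [H] and the long path of length $2n$ is the countermodel; if $a
    = 0$, then mu is not in [H] and the short path serves. Both omit t - u, so every $\gamma_m^D$
    holds. *)
Lemma U_ngamma (H : {set F25}) (p q : enat) n :
  let a := emax p (Fin (Mu \in H)) in
  1 <= n ->
  class_satisfies (U H p q) (gamma n) ->
  ele (Fin n) (if (H :&: I0 != set0) || ((Eta \in H) && ele (Fin 1) a)
               then Inf else a).
Proof.
move=> a n_gt0 Un; case: ifPn => //.
rewrite negb_or negbK => /andP[/eqP HI0 etaH].
apply: contraT => na.
have nI0 i : i \in H -> i \notin I0 by exact: setI_eq0_notin.
have [a1|a0] := boolP (ele (Fin 1) a).
- have n_gt1 : 1 < n.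
    by rewrite ltn_neqAle n_gt0 andbT; apply: contraNneq na => <-.
  case: (@long_model_ngamma n false n_gt1); apply: Un; split.
  + exact: path_model_variety.
  + move=> i iH; apply: path_model_nI0 => //; first exact: end_marks_even.
    * exact: nI0.
    * by move=> iE; rewrite -iE iH a1 in etaH.
    * by move=> _; exact: long_model_mu.
  + move=> m m0 mp; apply: long_model_gamma => //.
    rewrite ltnNge; apply: contra na => nm; rewrite ele_max; apply/orP; left.
    by case: (p) mp => //= k; exact: leq_trans.
  + by move=> m _ _; exact: (@path_model_D _ _ false (@end_marks_even n) isT).
- have [p0 mu0] : ~~ ele (Fin 1) p /\ Mu \notin H.
    by move: a0; rewrite ele_max negb_or => /andP[-> /=]; case: (Mu \in H).
  case: (@short_model_ngamma false n n_gt0); apply: Un; split.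
  + exact: path_model_variety.
  + move=> i iH; apply: path_model_nI0 => //; first exact: short_marks_even.
    * exact: nI0.
    * by move=> _; exact: short_model_eta.
    * by move=> iE; rewrite -iE iH in mu0.
  + move=> m m0 mp; case/negP: p0.
    by case: (p) mp => //= k; exact: leq_trans.
  + by move=> m _ _; exact: (@path_model_D _ _ false short_marks_even isT).
Qed.

(** The countermodels are the same paths with t - u adjoined. As $p \le q < n$ on the long path, its
    valid $\gamma_m$ cover both families. *)
Lemma U_ngammaD (H : {set F25}) (p q : enat) n : ele p q ->
  let b := emax q (Fin (H :&: [set Mu; MuD] != set0)) in
  1 <= n ->
  class_satisfies (U H p q) (gammaD n) ->
  ele (Fin n) (if (H :&: ID != set0)
        || ((H :&: [set Eta; EtaD] != set0) && ele (Fin 1) b)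
     then Inf else b).
Proof.
move=> pq b n_gt0 Un; case: ifPn => //.
rewrite negb_or negbK => /andP[/eqP HID etaH].
apply: contraT => nb.
have nID i : i \in H -> i \notin ID by exact: setI_eq0_notin.
have [b1|b0] := boolP (ele (Fin 1) b).
- have n_gt1 : 1 < n.
    by rewrite ltn_neqAle n_gt0 andbT; apply: contraNneq nb => <-.
  have eta0 : H :&: [set Eta; EtaD] = set0.
    by apply/eqP; move: etaH; rewrite b1 andbT negbK.
  have gm m : 0 < m -> ele (Fin m) q -> satisfies (long_model n true) (gamma m).
    move=> m0 mq; apply: long_model_gamma => //.
    rewrite ltnNge; apply: contra nb => nm; rewrite ele_max; apply/orP; left.
    by case: (q) mq => //= k; exact: leq_trans.
  case: (@long_model_ngammaD n true n_gt1 isT); apply: Un; split.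
  + exact: path_model_variety.
  + move=> i iH; have [iMu|iMu] := boolP (i \in [set Mu; MuD]).
      have mu := @long_model_mu n true n_gt1.
      move: iMu; rewrite !inE => /orP[] /eqP-> //.
      exact: path_model_Mu.
    apply: path_model_nID (nID _ iH) _; first exact: end_marks_even.
    have := setI_eq0_notin eta0 iH; move: iMu; rewrite !inE.
    by case: i {iH}.
  + by move=> m m0 mp; apply: gm => //; exact: ele_trans pq.
  + move=> m m0 mq; apply: gamma_gammaD => //; last exact: gm.
    exact: path_model_variety.
- have [q0 /negPn/eqP mu0] :
      ~~ ele (Fin 1) q /\ ~~ (H :&: [set Mu; MuD] != set0).
    by move: b0; rewrite ele_max negb_or => /andP[-> /=]; case: (_ != _).
  have q0F m : 0 < m -> ele (Fin m) q -> False.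
    move=> m0 mq; case/negP: q0.
    by case: (q) mq => //= k; exact: leq_trans.
  case: (@short_model_ngammaD true n isT n_gt0); apply: Un; split.
  + exact: path_model_variety.
  + move=> i iH; have [iEta|iEta] := boolP (i \in [set Eta; EtaD]).
      have eta := @short_model_eta true.
      move: iEta; rewrite !inE => /orP[] /eqP-> //.
      exact: path_model_Eta.
    apply: path_model_nID (nID _ iH) _; first exact: short_marks_even.
    have := setI_eq0_notin mu0 iH; move: iEta; rewrite !inE.
    by case: i {iH}.
  + by move=> m m0 mp; case: (q0F m m0); exact: ele_trans pq.
  + by move=> m m0 /q0F; case/(_ m0).
Qed.

Lemma is_esup_initial (P : nat -> Prop) s :
  (forall n, P n <-> 1 <= n /\ ele (Fin n) s) -> is_esup P s.
Proof.
move=> PE; split=> [n /PE[] //|s' ub].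
case: s PE => [[|k]|] PE; first by case: s' {ub}.
  by apply: ub; apply/PE; split=> //=.
case: s' ub => // m ub; have /= := ub m.+1 ((PE m.+1).2 (conj isT isT)).
by rewrite ltnn.
Qed.

Theorem theorem7p1 (H : {set F25}) (p q : enat) (hpq : ele p q) :
  let a := emax p (Fin (Mu \in H)) in
  let b := emax q (Fin (H :&: [set Mu; MuD] != set0)) in
  is_esup (fun n => 1 <= n /\ class_satisfies (U H p q) (gamma n))
    (if (H :&: I0 != set0) || ((Eta \in H) && ele (Fin 1) a)
     then Inf else a) /\
  is_esup (fun n => 1 <= n /\ class_satisfies (U H p q) (gammaD n))
    (if (H :&: ID != set0)
        || ((H :&: [set Eta; EtaD] != set0) && ele (Fin 1) b)
     then Inf else b).
Proof.
move=> a b; split; apply: is_esup_initial => n; split=> -[n_gt0 hn]; split=> //.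
- exact: U_ngamma hn.
- exact: U_gamma hn.
- exact: U_ngammaD hn.
- exact: U_gammaD hn.
Qed.
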